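(* Consider the Lyapunov equation with real coefficient matrices $$A X E^{\mathsf T} + E X A^{\mathsf T} + B R B^{\mathsf T} = 0,$$ where $A, E \in \mathbb{R}^{n\times n}$, $B \in \mathbb{R}^{n\times m}$ and $R\in\mathbb{R}^{m\times m}$ is symmetric, $E$ is invertible and all eigenvalues of the matrix pencil $\lambda E - A$ lie in the open left half-plane $\mathbb{C}_-$, and assume that $R$ is invertible. Let $X_{j-1}$ be the tangential ADI iterate at step $j-1$, let its residual factor $W_{j-1}$ be real-valued, let the next two ADI shifts be complex conjugates, $\alpha_j\in\mathbb{C}_-$ and $\alpha_{j+1} = \overline{\alpha_j}$, and let the corresponding tangential directions be identical and real, $t_j\in\mathbb{R}^m$ and $t_{j+1}=t_j$. Then the iterate after two tangential ADI steps is real-valued, $X_{j+1}\in\mathbb{R}^{n\times n}$, and can be written via a rank-$2$ update of the form $$X_{j+1} = X_{j-1} + \begin{bmatrix} f_j & f_{j+1}\end{bmatrix}\begin{bmatrix} d_j & 0\\ 0 & d_j\end{bmatrix}\begin{bmatrix} f_j^{\mathsf T}\\ f_{j+1}^{\mathsf T}\end{bmatrix},$$ where the update components are given by $$f_j = \sqrt{2}\,\big(\operatorname{Re}(v_j) + \delta_j \operatorname{Im}(v_j)\big),\qquad f_{j+1} = \sqrt{2}\,\sqrt{\delta_j^2+1}\;\operatorname{Im}(v_j),\qquad d_j = \frac{-2\operatorname{Re}(\alpha_j)}{t_j^{\mathsf T} R^{-1} t_j},$$ with the scaling factor $\delta_j = \operatorname{Re}(\alpha_j)/\operatorname{Im}(\alpha_j)$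 and the vector $v_j = (A+\alpha_j E)^{-1} W_{j-1} t_j$. The corresponding residual factor is given by $$W_{j+1} = W_{j-1} - \frac{4\operatorname{Re}(\alpha_j)\, E\big(\operatorname{Re}(v_j) + \delta_j\operatorname{Im}(v_j)\big) t_j^{\mathsf T} R^{-1}}{t_j^{\mathsf T} R^{-1} t_j}.$$
   Context: $M^{\mathsf H}$ and $M^{\mathsf T}$ denote conjugate transpose and transpose, $\mathbb{C}_-=\{z\in\mathbb{C}:\operatorname{Re} z<0\}$, and $\operatorname{Re}$, $\operatorname{Im}$ of a vector are taken entrywise. The tangential ADI (alternating direction implicit) iteration generates approximations $X_k$ of the solution of the Lyapunov equation, starting from $X_0=0$ and $W_0=B$. In step $k$, given $(X_{k-1},W_{k-1})$, a shift $\alpha_k\in\mathbb{C}_-$ and a tangential direction $t_k\in\mathbb{C}^m$, let $v_k$ solve $(A+\alpha_kE)v_k=W_{k-1}t_k$ and set $$X_k = X_{k-1} + \frac{-2\operatorname{Re}(\alpha_k)}{t_k^{\mathsf H}R^{-1}t_k}\, v_kv_k^{\mathsf H},\qquad W_k = W_{k-1} - \frac{2\operatorname{Re}(\alpha_k)\,E v_k t_k^{\mathsf H}R^{-1}}{t_k^{\mathsf H}R^{-1}t_k}.$$ The matrix $W_k\in\mathbb{C}^{n\times m}$ is called the residual factor, since the Lyapunov residual satisfies $AX_kE^{\mathsf T}+EX_kA^{\mathsf T}+BRB^{\mathsf T}=W_kRW_k^{\mathsf H}$. The statement concerns two consecutive such steps with a conjugate pair of non-real shifts; real shifts are handled by a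 single step. The matrix $R$ may be indefinite. *)

(* Defs.v *)
From mathcomp Require Import all_boot all_order all_algebra.
From mathcomp Require Import reals.
From mathcomp Require Export complex.

Set Implicit Arguments.
Unset Strict Implicit.
Unset Printing Implicit Defensive.

Import Order.TTheory GRing.Theory Num.Theory.
Local Open Scope ring_scope.
Local Open Scope complex_scope.
Local Open Scope sesquilinear_scope.

Notation cmx A := (map_mx (real_complex _) A).
Notation remx v := (map_mx (@complex.Re _) v).
Notation immx v := (map_mx (@complex.Im _) v).

Section TangentialADI.
Variables (K : realType) (n m : nat).

Definition pencil_eigenvalue (A E : 'M[K[i]]_n) (lam : K[i]) : Prop :=
  \det (lam *: E - A) = 0.

Definition tangential_weight (R : 'M[K[i]]_m) (t : 'cV[K[i]]_m) : K[i] :=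
  (t ^t* *m invmx R *m t) 0 0.

(* The second clause is needed for the quotients in the updates to be
   meaningful, since R may be indefinite. *)
Definition tangential_adi_step (A E : 'M[K]_n) (R : 'M[K]_m)
    (alpha : K[i]) (t : 'cV[K[i]]_m)
    (X : 'M[K[i]]_n) (W : 'M[K[i]]_(n, m))
    (X' : 'M[K[i]]_n) (W' : 'M[K[i]]_(n, m)) : Prop :=
  let w := tangential_weight (cmx R) t in
  exists v : 'cV[K[i]]_n,
    [/\ (cmx A + alpha *: cmx E) *m v = W *m t,
        w != 0,
        X' = X + ((- 2 * complex.Re alpha)%:C / w) *: (v *m v ^t*) &
        W' = W - ((2 * complex.Re alpha)%:C / w)
                   *: (cmx E *m v *m t ^t* *m invmx (cmx R))].

(* Steps are numbered from 1: alpha 0 and t 0 play no role. *)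
Definition tangential_adi (A E : 'M[K]_n) (B : 'M[K]_(n, m)) (R : 'M[K]_m)
    (alpha : nat -> K[i]) (t : nat -> 'cV[K[i]]_m)
    (N : nat) (X : nat -> 'M[K[i]]_n) (W : nat -> 'M[K[i]]_(n, m)) : Prop :=
  [/\ X 0%N = 0, W 0%N = cmx B &
      forall k, (0 < k <= N)%N ->
        complex.Re (alpha k) < 0 /\
        tangential_adi_step A E R (alpha k) (t k)
          (X k.-1) (W k.-1) (X k) (W k)].

End TangentialADI.

(* Main.v *)
(* Reality of X_(j-1) is not a hypothesis: the residual identity
   A X_k E^T + E X_k A^T + B R B^T = W_k R W_k^H, preserved by every step, shows
   that X_(j-1) solves a Lyapunov equation with real data when W_(j-1) is real;
   its complex conjugate solves the same equation, whose solution is unique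
   because the pencil is stable.
   For the update, comparing the first linear system with its conjugate gives
   (A + conj(alpha) E) Im v = - Im(alpha) E v, so the second system is solved by conj(v) + 2 delta Im v. *)

Require Import Defs.
From mathcomp Require Import all_boot all_order all_algebra.
From mathcomp Require Import reals complex ring.

Set Implicit Arguments.
Unset Strict Implicit.
Unset Printing Implicit Defensive.

Import Order.TTheory GRing.Theory Num.Theory.
Local Open Scope ring_scope.
Local Open Scope complex_scope.

(** * Uniqueness for Sylvester and Lyapunov equations *)

Lemma eigenvalue_det (F : fieldType) n (M : 'M[F]_n) a :
  eigenvalue M a = (\det (a%:M - M) == 0).
Proof.
rewrite /eigenvalue /eigenspace kermx_eq0 row_free_unit unitmxE unitfE negbK.
by rewrite -opprB -scaleN1r detZ mulf_eq0 signr_eq0.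
Qed.

Lemma horner_mx_intertwine (F : comNzRingType) n (M N Y : 'M[F]_n.+1) q :
  M * Y = Y * N -> horner_mx M q * Y = Y * horner_mx N q.
Proof.
move=> MY; elim/poly_ind: q => [|q c IH]; first by rewrite !rmorph0 mul0r mulr0.
rewrite !(rmorphD, rmorphM) /= !horner_mx_X !horner_mx_C mulrDl mulrDr.
by rewrite -mulrA MY mulrA IH mulrA; congr (_ + _); rewrite -mulmxE scalar_mxC.
Qed.

(* The characteristic polynomial of M kills M, so its value at N, a product of
   invertible factors N - z, kills Y on the right. *)
Lemma sylvester_eq0 (F : closedFieldType) n (M N Y : 'M[F]_n) :
  (forall a, eigenvalue M a -> ~~ eigenvalue N a) -> M *m Y = Y *m N -> Y = 0.
Proof.
case: n M N Y => [|n] M N Y MN; first by rewrite [Y]thinmx0.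
move=> /(horner_mx_intertwine (char_poly M)).
rewrite Cayley_Hamilton mul0r.
have [r defp] := closed_field_poly_normal (char_poly M).
rewrite (monicP (char_poly_monic M)) scale1r in defp.
have U : horner_mx N (char_poly M) \is a GRing.unit.
  rewrite defp rmorph_prod /=.
  have : all (root (char_poly M)) r.
    by apply/allP => z; rewrite defp root_prod_XsubC.
  elim: r {defp} => [|z r IH] /=; first by rewrite big_nil unitr1.
  case/andP=> rz /IH rr; rewrite big_cons unitrMl //.
  rewrite rmorphB /= horner_mx_X horner_mx_C.
  rewrite -eigenvalue_root_char in rz; have := MN _ rz.
  by rewrite /eigenvalue /eigenspace kermx_eq0 row_free_unit negbK.
by move=> Y0; rewrite -[Y](mulrK U) -Y0 mul0r.
Qed.

(** Cancelling [E] on the left and [E^T] on the right leaves a Sylvester equation for [invmx E *m A]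
    and the negative of its transpose, whose spectra lie in opposite open half-planes. *)
Lemma lyapunov_eq0 (K : rcfType) n (A E Y : 'M[K[i]]_n) :
  E \in unitmx ->
  (forall z : K[i], \det (z *: E - A) = 0 -> complex.Re z < 0) ->
  A *m Y *m E^T + E *m Y *m A^T = 0 -> Y = 0.
Proof.
move=> Eu stab AY.
have ET : E^T \in unitmx by rewrite unitmx_tr.
apply: (@sylvester_eq0 _ _ (invmx E *m A) (- (A^T *m invmx E^T))) => [a|].
  have half z : \det (z%:M - invmx E *m A) = 0 -> complex.Re z < 0.
    move=> dz; apply: stab.
    suff -> : z *: E - A = E *m (z%:M - invmx E *m A).
      by rewrite det_mulmx dz mulr0.
    by rewrite mulmxBr mulKVmx // mul_mx_scalar.
  rewrite !eigenvalue_det opprK => /eqP /half a_lt0; apply/negP => /eqP.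
  (* An eigenvalue [a] of the second Sylvester coefficient makes [- a] an eigenvalue of
     [invmx E *m A]. *)
  have -> : a%:M + A^T *m invmx E^T = - ((- a)%:M - invmx E *m A)^T.
    by rewrite linearB /= tr_scalar_mx trmx_mul trmx_inv raddfN opprB opprK
               addrC.
  rewrite -scaleN1r detZ det_tr => /eqP.
  rewrite mulf_eq0 signr_eq0 /= => /eqP /half.
  by rewrite raddfN /= oppr_lt0 ltNge (ltW a_lt0).
apply: (can_inj (mulKmx Eu)); apply: (can_inj (mulmxK ET)).
rewrite !mulmxN mulNmx !mulmxA mulmxV // mul1mx mulmxKV //.
by apply/eqP; rewrite -addr_eq0 AY.
Qed.

(** * Invariance of the Lyapunov residual under one step *)

Section StepResidual.
Local Open Scope sesquilinear_scope.
Variable C : numClosedFieldType.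

Lemma trmxC_mul m n p (A : 'M[C]_(m, n)) (B : 'M[C]_(n, p)) :
  (A *m B)^t* = B^t* *m A^t*.
Proof. by rewrite trmx_mul map_mxM. Qed.

(** Put p = A v and q = E v. Since W t = p + alpha q, both the Lyapunov part and W R W^H change by
    -c (p q^H + q p^H): the quadratic term c^2 w q q^H absorbs the remaining multiples of q q^H
    because c w = alpha + conj(alpha). *)
Lemma adi_step_residual n m (A E : 'M[C]_n) (R : 'M[C]_m) (alpha : C)
    (t : 'cV[C]_m) (v : 'cV[C]_n) (X X' : 'M[C]_n) (W W' : 'M[C]_(n, m)) :
  R^t* = R -> R \in unitmx ->
  let w := (t^t* *m invmx R *m t) 0 0 in
  let c := (alpha + Num.conj alpha) / w in
  (A + alpha *: E) *m v = W *m t -> w != 0 ->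
  X' = X - c *: (v *m v^t*) ->
  W' = W - c *: (E *m v *m t^t* *m invmx R) ->
  A *m X' *m E^t* + E *m X' *m A^t* - W' *m R *m W'^t*
  = A *m X *m E^t* + E *m X *m A^t* - W *m R *m W^t*.
Proof.
move=> RH Ru w c vP w0 X'E W'E.
(* s, p and q are kept opaque: rewriting with mulmxA would unfold them. *)
have [s sE] : exists x, x = t^t* *m invmx R by eexists.
have iRH : (invmx R)^t* = invmx R by rewrite trmx_inv map_invmx RH.
have sR : s *m R = t^t* by rewrite sE mulmxKV.
have sH : s^t* = invmx R *m t by rewrite sE trmxC_mul iRH trmxCK.
have st : s *m t = w%:M by rewrite sE; exact: mx11_scalar.
(* [s *m t] is a 1 x 1 Hermitian matrix, as [R] is Hermitian. *)
have w_real : Num.conj w = w.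
  have : (s *m t)^t* = s *m t by rewrite trmxC_mul sH sE mulmxA.
  by move/matrixP/(_ 0 0); rewrite st !mxE.
have c_real : Num.conj c = c.
  by rewrite /c rmorphM fmorphV rmorphD /= w_real conjCK addrC.
have cw : c * w = alpha + Num.conj alpha by rewrite /c mulfVK.
have [p pE] : exists x, x = A *m v by eexists.
have [q qE] : exists x, x = E *m v by eexists.
have Wt : W *m t = p + alpha *: q by rewrite -vP mulmxDl -scalemxAl pE qE.
have tW : t^t* *m W^t* = p^t* + Num.conj alpha *: q^t*.
  by rewrite -trmxC_mul Wt linearD linearZ /= map_mxD map_mxZ.
have -> : W' = W - c *: (q *m s) by rewrite W'E qE sE !mulmxA.
have -> : (W - c *: (q *m s))^t* = W^t* - c *: (s^t* *m q^t*).
  by rewrite linearB linearZ map_mxB map_mxZ /= c_real trmxC_mul.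
have -> : (W - c *: (q *m s)) *m R *m (W^t* - c *: (s^t* *m q^t*)) =
  W *m R *m W^t* - c *: (q *m (p^t* + Num.conj alpha *: q^t*))
   - c *: ((p + alpha *: q) *m q^t*) + (c * (c * w)) *: (q *m q^t*).
  rewrite !mulmxBl !mulmxBr -!scalemxAl -!scalemxAr -!mulmxA.
  have -> : s *m (R *m (s^t* *m q^t*)) = w *: q^t*.
    by rewrite !mulmxA sR -mul_scalar_mx -st sH sE !mulmxA.
  have -> : R *m (s^t* *m q^t*) = t *m q^t* by rewrite sH -mulmxA mulKVmx.
  have -> : s *m (R *m W^t*) = t^t* *m W^t* by rewrite mulmxA sR.
  rewrite tW (mulmxA W t) Wt -!scalemxAr !scalerA.
  by apply/matrixP=> i k; rewrite !mxE !big_ord1 !mxE; ring.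
have -> : A *m X' *m E^t* = A *m X *m E^t* - c *: (p *m q^t*).
  rewrite X'E mulmxBr mulmxBl -scalemxAr -scalemxAl.
  by rewrite pE qE trmxC_mul !mulmxA.
have -> : E *m X' *m A^t* = E *m X *m A^t* - c *: (q *m p^t*).
  rewrite X'E mulmxBr mulmxBl -scalemxAr -scalemxAl.
  by rewrite pE qE trmxC_mul !mulmxA.
rewrite cw; apply/matrixP=> i k; rewrite !mxE !big_ord1 !mxE.
ring.
Qed.

End StepResidual.

(** * Real data: residual identity and reality of the iterates *)

Section ComplexifiedADI.
Local Open Scope sesquilinear_scope.
Variable K : realType.
Implicit Type z : K[i].

Lemma conjC_conjc z : Num.conj z = conjc z. Proof. by []. Qed.

Lemma trmxC_cmx n m (M : 'M[K]_(n, m)) : (cmx M)^t* = cmx M^T.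
Proof. by apply/matrixP=> i k; rewrite !mxE conjC_conjc conjc_real. Qed.

Lemma addC_conj z : z + Num.conj z = (2 * complex.Re z)%:C.
Proof.
by case: z => a b; apply/eqP; rewrite eq_complex /= subrr mulr_natl mulr2n !eqxx.
Qed.

(** Otherwise [- z] would be an eigenvalue of the pencil with positive real part. *)
Lemma shifted_pencil_unit n (A E : 'M[K]_n) z :
  (forall lam : K[i],
     pencil_eigenvalue (cmx A) (cmx E) lam -> complex.Re lam < 0) ->
  complex.Re z < 0 -> cmx A + z *: cmx E \in unitmx.
Proof.
move=> stab z_lt0; rewrite unitmxE unitfE; apply/eqP => dz.
have : complex.Re (- z) < 0.
  apply: stab; rewrite /pencil_eigenvalue scaleNr -opprD addrC -scaleN1r detZ.
  by rewrite dz mulr0.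
by rewrite raddfN /= oppr_lt0 ltNge (ltW z_lt0).
Qed.

(** Every step preserves the left-hand side; the right-hand side is its value at the start, where X
    = 0 and W = B. *)
Lemma tangential_adi_residual n m (A E : 'M[K]_n) (B : 'M[K]_(n, m))
    (R : 'M[K]_m) alpha t N X W k :
  R^T = R -> R \in unitmx -> tangential_adi A E B R alpha t N X W ->
  (k <= N)%N ->
  cmx A *m X k *m (cmx E)^t* + cmx E *m X k *m (cmx A)^t*
    - W k *m cmx R *m (W k)^t* = - (cmx B *m cmx R *m (cmx B)^t*).
Proof.
move=> Rs Ru [X0 W0 step].
have RH : (cmx R)^t* = cmx R by rewrite trmxC_cmx Rs.
have RU : cmx R \in unitmx by rewrite map_unitmx.
elim: k => [_|k IH kN].
  by rewrite X0 W0 !(mulmx0, mul0mx) addr0 sub0r.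
rewrite -(IH (ltnW kN)).
have [_ [v [vP w0 Xk Wk]]] := step k.+1 kN.
apply: (adi_step_residual RH RU vP w0); rewrite addC_conj.
  by rewrite Xk mulNr rmorphN /= mulNr scaleNr.
exact: Wk.
Qed.

Lemma conj_cmx p q (M : 'M[K]_(p, q)) : map_mx conjc (cmx M) = cmx M.
Proof. by apply/matrixP=> i l; rewrite !mxE conjc_real. Qed.

Lemma cmx_remx p q (M : 'M[K[i]]_(p, q)) :
  M \is a mxOver Num.real -> cmx (remx M) = M.
Proof. by move/mxOverP=> Mr; apply/matrixP=> i l; rewrite !mxE RRe_real. Qed.

Lemma lyapunov_real n (A E S : 'M[K]_n) (X : 'M[K[i]]_n) :
  E \in unitmx ->
  (forall lam : K[i],
     pencil_eigenvalue (cmx A) (cmx E) lam -> complex.Re lam < 0) ->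
  cmx A *m X *m cmx E^T + cmx E *m X *m cmx A^T = cmx S ->
  X \is a mxOver Num.real.
Proof.
move=> Eu stab eqX.
have eqXc : cmx A *m map_mx conjc X *m cmx E^T
            + cmx E *m map_mx conjc X *m cmx A^T = cmx S.
  by rewrite -[RHS]conj_cmx -eqX map_mxD; congr (_ + _);
    rewrite map_mxM [X in _ = _ *m X]conj_cmx map_mxM
            [X in _ = X *m _ *m _]conj_cmx.
have XX : X - map_mx conjc X = 0.
  apply: (@lyapunov_eq0 _ _ (cmx A) (cmx E)) => //; first by rewrite map_unitmx.
  rewrite !map_trmx !(mulmxBr, mulmxBl) addrACA -opprD eqX eqXc.
  exact: subrr.
apply/mxOverP=> i l; apply/CrealP; rewrite conjC_conjc.
by move/matrixP/(_ i l)/eqP: XX; rewrite !mxE subr_eq0 => /eqP <-.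
Qed.

Lemma tangential_adi_real n m (A E : 'M[K]_n) (B : 'M[K]_(n, m))
    (R : 'M[K]_m) alpha t N X W k :
  R^T = R -> R \in unitmx -> E \in unitmx ->
  (forall lam : K[i],
     pencil_eigenvalue (cmx A) (cmx E) lam -> complex.Re lam < 0) ->
  tangential_adi A E B R alpha t N X W -> (k <= N)%N ->
  W k \is a mxOver Num.real -> X k \is a mxOver Num.real.
Proof.
move=> Rs Ru Eu stab adi kN Wr.
have := tangential_adi_residual Rs Ru adi kN.
rewrite -(cmx_remx Wr) !trmxC_cmx; set V := remx (W k) => res.
(* This real matrix is what the residual identity prescribes as right-hand side of the Lyapunov
   equation for [X k]. *)
apply: (@lyapunov_real _ A E (V *m R *m V^T - B *m R *m B^T)) => //.
rewrite map_mxB !map_mxM; move/eqP: res; rewrite subr_eq => /eqP ->.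
by rewrite addrC.
Qed.

(** * Two steps with conjugate shifts and a common real direction *)

Lemma tangential_weight_cmx m (R : 'M[K]_m) (t : 'cV[K]_m) :
  tangential_weight (cmx R) (cmx t) = ((t^T *m invmx R *m t) 0 0)%:C.
Proof. by rewrite /tangential_weight trmxC_cmx -map_invmx -!map_mxM mxE. Qed.

(** Under A + conj(alpha) E, the conjugate of v maps to W t, so the other term must supply W' t - W
    t = -2 Re(alpha) E v; this fixes its factor 2 delta. *)
Lemma conj_step_solution n m (A E : 'M[K]_n) (R : 'M[K]_m) alpha
    (t : 'cV[K]_m) (W W' : 'M[K[i]]_(n, m)) (v v' : 'cV[K[i]]_n) :
  (forall lam : K[i],
     pencil_eigenvalue (cmx A) (cmx E) lam -> complex.Re lam < 0) ->
  complex.Re alpha < 0 -> complex.Im alpha != 0 ->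
  let w := ((t^T *m invmx R *m t) 0 0)%:C in
  W \is a mxOver Num.real -> w != 0 ->
  (cmx A + alpha *: cmx E) *m v = W *m cmx t ->
  W' = W - ((2 * complex.Re alpha)%:C / w)
            *: (cmx E *m v *m cmx t^T *m invmx (cmx R)) ->
  (cmx A + conjc alpha *: cmx E) *m v' = W' *m cmx t ->
  v' = map_mx conjc v
       + ((2 * (complex.Re alpha / complex.Im alpha))%:C *: cmx (immx v)).
Proof.
move=> stab a_lt0 b0 w Wr w0 vP W'E v'P.
have conj_lt0 : complex.Re (conjc alpha) < 0 by case: (alpha) a_lt0.
have U := shifted_pencil_unit stab conj_lt0.
apply: (can_inj (mulKmx U)); rewrite v'P mulmxDr -scalemxAr.
have vcP : (cmx A + conjc alpha *: cmx E) *m map_mx conjc v = W *m cmx t.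
  rewrite -(cmx_remx Wr) -map_mxM -[RHS]conj_cmx map_mxM cmx_remx // -vP.
  rewrite [RHS]map_mxM; congr (_ *m _).
  by rewrite map_mxD map_mxZ !conj_cmx.
(* Written this way, only the images of v and of its conjugate under the second shifted matrix are
   needed. *)
have -> : cmx (immx v) = (2 * 'i)^-1 *: (v - map_mx conjc v).
  apply/matrixP=> i k; rewrite !mxE subcJ mulrAC mulKf //.
  by rewrite mulf_neq0 ?pnatr_eq0 // eq_complex /= oner_eq0 andbF.
rewrite vcP -scalemxAr mulmxBr vcP.
have -> : (cmx A + conjc alpha *: cmx E) *m v
          = W *m cmx t - (2 * (complex.Im alpha)%:C * 'i) *: (cmx E *m v).
  rewrite -vP -subcJ !mulmxDl -!scalemxAl -addrA; congr (_ + _).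
  by rewrite scalerBl opprB addrC subrK.
have -> : W' *m cmx t = W *m cmx t - (2 * complex.Re alpha)%:C *: (cmx E *m v).
  rewrite W'E mulmxBl -scalemxAl -!mulmxA.
  have -> : cmx t^T *m (invmx (cmx R) *m cmx t) = w%:M.
    by rewrite -map_invmx -!map_mxM mulmxA [LHS]mx11_scalar mxE.
  by rewrite mul_mx_scalar -scalemxAr scalerA mulfVK.
(* The copies of W t cancel; what remains is to compare the coefficients of E v. *)
congr (_ + _); rewrite addrAC subrr add0r !scalerN; congr (- _).
rewrite !scalerA; congr (_ *: _).
have i0 : 2 * 'i != 0 :> K[i].
  by rewrite mulf_neq0 ?pnatr_eq0 // eq_complex /= oner_eq0 andbF.
rewrite [2 * _ * 'i]mulrAC -mulrA mulKf // -rmorphM /=; congr _%:C.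
by rewrite -mulrA mulfVK.
Qed.

(** Both steps carry the same coefficient, so the residual factor changes through E applied to this
    sum, in which the imaginary parts cancel. *)
Lemma conj_pair_sum n (v : 'cV[K[i]]_n) delta :
  v + (map_mx conjc v + (2 * delta)%:C *: cmx (immx v))
  = cmx (2 *: (remx v + delta *: immx v)).
Proof.
apply/matrixP=> i k; rewrite !mxE.
case: (v i k) => x y; apply/eqP; rewrite eq_complex /=.
by apply/andP; split; apply/eqP; ring.
Qed.

(** Here v = x - (delta - i) Im v and v' = x + (delta - i) Im v, so the cross terms cancel and
    |delta - i|^2 = delta^2 + 1 remains. *)
Lemma conj_pair_outer n (v : 'cV[K[i]]_n) delta :
  let v' := map_mx conjc v + (2 * delta)%:C *: cmx (immx v) in
  let x := remx v + delta *: immx v in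
  v *m v^t* + v' *m v'^t*
  = cmx (2 *: (x *m x^T) + (2 * (delta ^+ 2 + 1)) *: (immx v *m (immx v)^T)).
Proof.
apply/matrixP=> i k; rewrite !mxE !big_ord1 !mxE !conjC_conjc.
case: (v i 0) (v k 0) => [xi yi] [xk yk]; apply/eqP; rewrite eq_complex /=.
by apply/andP; split; apply/eqP; ring.
Qed.

End ComplexifiedADI.

Theorem theorem2 (K : realType) (n m : nat)
    (A E : 'M[K]_n) (B : 'M[K]_(n, m)) (R : 'M[K]_m)
    (R_sym : R^T = R)
    (E_unit : E \in unitmx)
    (pencil_stable : forall lam : K[i],
        pencil_eigenvalue (cmx A) (cmx E) lam -> complex.Re lam < 0)
    (R_unit : R \in unitmx)
    (alpha : nat -> K[i]) (t : nat -> 'cV[K[i]]_m)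
    (X : nat -> 'M[K[i]]_n) (W : nat -> 'M[K[i]]_(n, m))
    (j : nat) (j_gt0 : (0 < j)%N)
    (adi : tangential_adi A E B R alpha t j.+1 X W)
    (W_real : W j.-1 \is a mxOver Num.real)
    (alpha_nonreal : complex.Im (alpha j) != 0)
    (alpha_conj : alpha j.+1 = Num.conj (alpha j))
    (tj : 'cV[K]_m) (t_real : t j = cmx tj) (t_same : t j.+1 = t j) :
  let v := invmx (cmx A + alpha j *: cmx E) *m (W j.-1 *m t j) in
  let delta := complex.Re (alpha j) / complex.Im (alpha j) in
  let w := (tj^T *m invmx R *m tj) 0 0 in
  let d := - 2 * complex.Re (alpha j) / w in
  let f := Num.sqrt 2 *: (remx v + delta *: immx v) in
  let f' := (Num.sqrt 2 * Num.sqrt (delta ^+ 2 + 1)) *: immx v in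
  [/\ X j.+1 \is a mxOver Num.real,
      X j.+1 = X j.-1
               + cmx (row_mx f f'
                      *m block_mx d%:M 0 0 (d%:M : 'M_1)
                      *m col_mx f^T f'^T) &
      W j.+1 = W j.-1
               - cmx ((4 * complex.Re (alpha j) / w)
                        *: (E *m (remx v + delta *: immx v)
                              *m tj^T *m invmx R))].
Proof.
move=> v delta w d f f'.
have X_real : X j.-1 \is a mxOver Num.real.
  apply: (tangential_adi_real R_sym R_unit E_unit pencil_stable adi) => //.
  by rewrite (leq_trans (leq_pred j)).
case: adi => _ _ step.
have [|a_lt0 [v1 [v1P]]] := step j; first by rewrite j_gt0 leqnSn.
have [|_ [v2 [v2P _]]] := step j.+1; first by rewrite leqnn.
rewrite t_same alpha_conj conjC_conjc in v2P *.
rewrite t_real tangential_weight_cmx -/w trmxC_cmx /= in v1P v2P *.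
move=> X2 W2 w0 X1 W1.
(* The step only asserts some solution; invertibility of the shifted matrix identifies it with
   [v]. *)
have v1E : v1 = v.
  by rewrite /v t_real -v1P mulKmx // shifted_pencil_unit.
have v2E := conj_step_solution pencil_stable a_lt0 alpha_nonreal W_real w0
              v1P W1 v2P.
rewrite v1E -/delta in v2E X1 W1.
(* Conjugate shifts share their real part, so both rank-one updates have the weight [d]. *)
have Re_conj : complex.Re (conjc (alpha j)) = complex.Re (alpha j) by case: (alpha j).
rewrite Re_conj in X2 W2.
have XE : X j.+1 = X j.-1 + cmx (row_mx f f'
       *m block_mx d%:M 0 0 (d%:M : 'M_1) *m col_mx f^T f'^T).
  rewrite X2 X1 -addrA; congr (_ + _).
  rewrite mul_row_block !mulmx0 addr0 add0r mul_row_col !mul_mx_scalar.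
  rewrite -fmorphV -rmorphM /= -/d -scalerDr v2E.
  (* The square roots in [f] and [f'] split the weights 2 and 2 (delta^2 + 1) of the two outer
     products. *)
  have s2 : Num.sqrt 2 * Num.sqrt 2 = 2 :> K by rewrite -expr2 sqr_sqrtr.
  have sd : Num.sqrt (delta ^+ 2 + 1) * Num.sqrt (delta ^+ 2 + 1) = delta ^+ 2 + 1.
    by rewrite -expr2 sqr_sqrtr // addr_ge0 ?sqr_ge0.
  rewrite conj_pair_outer -map_mxZ /f /f' !linearZ /=.
  rewrite -!scalemxAl scalerDr !scalerA; congr (cmx (_ *: _ + _ *: _)).
    by rewrite s2 mulrC.
  by rewrite [X in _ = X * _]mulrACA s2 sd mulrC.
split; [|exact: XE|].
- rewrite XE; apply/mxOverP=> i k; rewrite mxE rpredD ?(mxOverP X_real) //.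
  by rewrite mxE; apply/complex_realP; eexists.
- rewrite W2 W1 -addrA -opprD; congr (_ - _).
  rewrite -fmorphV -rmorphM /= -scalerDr -!mulmxDl -mulmxDr.
  rewrite v2E conj_pair_sum -map_invmx -!map_mxM -map_mxZ; congr (cmx _).
  rewrite -scalemxAr -!scalemxAl scalerA; congr (_ *: _).
  by ring.
Qed.
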